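(* Let $p$ be an odd prime, let $c_1\in\overline{\mathbb{F}}_p[t]$ be a square, fix a square root $\sqrt{c_1}\in\overline{\mathbb{F}}_p[t]$, let $\eta\in\{1,-1\}$, and let $\phi=(x+c_1+\eta\sqrt{c_1})^2-c_1$ be non-isotrivial (equivalently $c_1$ non-constant). Let $e=\max\{i\in\mathbb{N}: c_1\in\overline{\mathbb{F}}_p(t)^{p^i}\}$ be its dynamical inseparability degree. Let $(c_n)$ be the adjusted post-critical orbit and, for each $n$, let $d_n$ be the squarefree part of $c_n$ (so $c_n=d_nz_n^2$ with $d_n,z_n\in\overline{\mathbb{F}}_p[t]$, $d_n$ squarefree). Let $\widetilde d_1$ be the squarefree part of $\sqrt{c_1}$. Then for every $n\geq 4$, $$h(c_{n-2})\leq A\,h(d_n)+B,$$ where $A=8p^e$ and $B=8p^e\big(h(\widetilde d_1)+4+4h(\operatorname{rad}(c_1))+4h(\operatorname{rad}(\sqrt{c_1}+2))\big)+10h(c_1)$.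
   Context: With $\gamma=-c_1-\eta\sqrt{c_1}$, the adjusted post-critical orbit is $c_1=-\phi(\gamma)$ and $c_n=\phi^{(n)}(\gamma)$ for $n\ge2$. For $f\in\overline{\mathbb{F}}_p[t]$, $h(f)=\deg f$ and $\operatorname{rad}f$ is the product of the distinct irreducible factors of $f$. *)

(* Defs.v *)
From mathcomp Require Import all_boot all_order all_algebra all_field.

Set Implicit Arguments.
Unset Strict Implicit.
Unset Printing Implicit Defensive.

Import GRing.Theory.
Local Open Scope ring_scope.

(* [k], together with [iota], is an algebraic closure of F_p: the type
   [closedFieldType] makes it algebraically closed, and every element is
   algebraic over the image of F_p. *)
Definition alg_closure_Fp (p : nat) (k : closedFieldType)
  (iota : {rmorphism 'F_p -> k}) : Prop := integralRange iota.

Section Polynomials.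
Variable k : fieldType.
Implicit Types f d r : {poly k}.

(* The degree; the zero polynomial gets height 0. *)
Definition height f : nat := (size f).-1.

Definition squarefree f : Prop :=
  forall u : {poly k}, size u != 1%N -> ~~ (u ^+ 2 %| f).

(* Over an algebraically closed field, [d] is unique up to a nonzero constant
   factor when [f != 0]; for [f = 0] any squarefree [d] qualifies. *)
Definition squarefree_part f d : Prop :=
  squarefree d /\ exists z : {poly k}, f = d * z ^+ 2.

(* [r] is the product of the distinct irreducible factors of [f], each
   represented by its monic associate. *)
Definition is_rad f r : Prop :=
  exists qs : seq {poly k},
    [/\ uniq qs,
        forall q : {poly k},
          q \in qs <-> [/\ q \is monic, irreducible_poly q & q %| f]
      & r = \prod_(q <- qs) q].

Definition is_power_in_frac f (m : nat) : Prop :=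
  exists g : {fraction {poly k}}, tofrac f = g ^+ m.

(* [e] is the largest natural number such that [f] is a [p ^ e]-th power in
   k(t). *)
Definition dyn_insep_degree (p : nat) f (e : nat) : Prop :=
  is_power_in_frac f (p ^ e) /\
  forall i : nat, is_power_in_frac f (p ^ i) -> (i <= e)%N.

(* [phi] is a polynomial in x with coefficients in k[t].  It is isotrivial
   when, over some finite extension L of k(t), it is conjugate by an affine
   map mu = a x + b to a polynomial psi with constant coefficients
   (phi o mu = mu o psi). *)
Definition isotrivial (phi : {poly {poly k}}) : Prop :=
  exists (L : fieldExtType {fraction {poly k}}) (a b : L) (psi : {poly k}),
    let toL (f : {poly k}) : L := (tofrac f)%:A in
    a != 0 /\
    map_poly toL phi \Po (a *: 'X + b%:P)
      = a *: map_poly (fun x : k => toL x%:P) psi + b%:P.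

(* In what follows [s] is the chosen square root of [c1]. *)

Definition phi_poly (c1 s : {poly k}) (eta : k) : {poly {poly k}} :=
  ('X + (c1 + eta *: s)%:P) ^+ 2 - c1%:P.

Definition crit_pt (c1 s : {poly k}) (eta : k) : {poly k} :=
  - c1 - eta *: s.

(* The value at n = 0 is irrelevant: the orbit is indexed by n >= 1. *)
Definition post_crit (c1 s : {poly k}) (eta : k) (n : nat) : {poly k} :=
  let phi := phi_poly c1 s eta in
  let gamma := crit_pt c1 s eta in
  if n == 1%N then - phi.[gamma] else iter n (horner phi) gamma.

End Polynomials.

(* Main.v *)
(* Put a = eta sqrt(c1).  After a translation the critical orbit becomes the
   orbit Y_m of 0 under y^2 + a, and
   c_n = Y_(n-1)^2 - a^2 = X^2 (X^2 + 2 a) with X = Y_(n-2) = Y^2 + a,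
   Y = Y_(n-3), so that d_n w^2 = X^2 + 2 a for some w.  Suppose a' <> 0.
   Differentiating, w divides the Wronskian W = X a' - 2 a X' = w q, where q has
   small degree, and d_n W^2 = q^2 (X^2 + 2 a).  Reducing this modulo Y gives
   d_n a^2 a'^2 = q^2 a (a + 2) mod Y, an equality once deg Y is larger than
   deg d_n + 4 deg a.  Eliminating d_n and q, and writing X = P(a), W = a' V(a),
   one gets (x + 2) V^2 = x (P^2 + 2 x) for V = P - 2 x P', which fails at
   order x^3 or x^4.  Hence deg c_(n-2) = 2 deg Y <= 2 deg d_n + 8 deg a.
   In general sqrt(c1) is a p^i-th power with i <= e of a polynomial with
   nonzero derivative; as p^i is odd, taking p^i-th powers preserves squarefree
   parts. *)
Require Import Defs.
From mathcomp Require Import all_boot all_order all_algebra all_field.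
From mathcomp Require Import ring zify.

Set Implicit Arguments.
Unset Strict Implicit.
Unset Printing Implicit Defensive.

Import GRing.Theory.
Local Open Scope ring_scope.

(** * The orbit of 0 under y^2 + a *)

Definition quad_orbit (R : comNzRingType) (a : R) (m : nat) : R :=
  iter m (fun y => y ^+ 2 + a) 0.

Lemma quad_orbitS (R : comNzRingType) (a : R) m :
  quad_orbit a m.+1 = quad_orbit a m ^+ 2 + a.
Proof. by []. Qed.

Lemma rmorph_quad_orbit (R S : comNzRingType) (f : {rmorphism R -> S}) a m :
  f (quad_orbit a m) = quad_orbit (f a) m.
Proof.
by elim: m => [|m IHm]; rewrite ?rmorph0 // !quad_orbitS rmorphD rmorphXn /= IHm.
Qed.

(** Raising to the power [P] is additive here, so it commutes with y^2 + a. This reduces a parameter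
    that is a [P]-th power to its root. *)
Lemma quad_orbit_exp_pchar (R : comNzRingType) (P : nat) (a : R) m :
  [pchar R].-nat P -> quad_orbit (a ^+ P) m = quad_orbit a m ^+ P.
Proof.
move=> Pchar; elim: m => [|m IHm].
  by rewrite /quad_orbit /= expr0n; case/andP: Pchar; case: P.
by rewrite !quad_orbitS IHm exprDn_pchar // -!exprM mulnC.
Qed.

(** Modulo x^4 the orbit is stationary from index 3 on: squaring x + x^2 + 2 x^3 and adding x gives
    the same truncation back. *)
Lemma quad_orbit_polyX (k : comNzRingType) m :
  exists r : {poly k}, quad_orbit 'X m.+3 = 'X + 'X^2 + 2%:R * 'X^3 + r * 'X^4.
Proof.
elim: m => [|m [r IHr]].
  by exists 1; rewrite /quad_orbit /=; ring.
exists (r * 'X * 2%:R + 5%:R + 4%:R * 'X + 4%:R * 'X^2 + 2%:R * r * 'X^2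
        + 4%:R * r * 'X^3 + r ^+ 2 * 'X^4).
by rewrite quad_orbitS IHr; ring.
Qed.

Lemma size_quad_orbit (k : fieldType) (f : {poly k}) m :
  (1 < size f)%N ->
  size (quad_orbit f m.+1) = ((2 ^ m) * (size f).-1).+1.
Proof.
move=> f_gt1; elim: m => [|m IHm].
  by rewrite /quad_orbit /= expr0n add0r mul1n; case: (size f) f_gt1.
have sz2 : size (quad_orbit f m.+1 ^+ 2) = (2 ^ m.+1 * (size f).-1).+1.
  have := size_exp (quad_orbit f m.+1) 2.
  have : size (quad_orbit f m.+1 ^+ 2) != 0%N.
    by rewrite size_poly_eq0 expf_eq0 -size_poly_eq0 IHm.
  rewrite IHm expnS -mulnA [(2 * (_ * _))%N]mulnC; by case: size => //= z _ ->.
rewrite quad_orbitS size_polyDl // sz2 ltnS.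
case: (size f) f_gt1 => [|[|D]] //= _.
by rewrite ltn_Pmull // -{1}(expn0 2) ltn_exp2l.
Qed.

(** The difference of the two sides starts with 12 x^3 + 62 x^4. Two orders are needed because 12
    vanishes in characteristic 3. *)
Lemma quad_orbit_no_identity (k : fieldType) m (X := quad_orbit 'X m.+3 : {poly k}) :
  2%:R != 0 :> k ->
  ('X + 2%:R) * (X - 2%:R * 'X * X^`()) ^+ 2 <> 'X * (X ^+ 2 + 2%:R * 'X).
Proof.
move=> two_neq0 /eqP; rewrite -subr_eq0.
have [r Xr] := quad_orbit_polyX k m.
have dX : X^`() = 1 + 2%:R * 'X + 6%:R * 'X^2 + (r^`() * 'X + 4%:R * r) * 'X^3.
  rewrite /X Xr !derivE /=; ring.
(* With these, X - 2 x X' = x ([a0] + [h] x^3) and X = x ([b0] + [r] x^3). The terms in x^2 cancel,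
   and [E] collects everything from x^5 on. *)
pose a0 : {poly k} := - 1 - 3%:R * 'X - 10%:R * 'X^2.
pose h : {poly k} := - 7%:R * r - 2%:R * r^`() * 'X.
pose b0 : {poly k} := 1 + 'X + 2%:R * 'X^2.
pose E : {poly k} := 144%:R + 256%:R * 'X + 96%:R * 'X^2
  + ('X + 2%:R) * (2%:R * a0 * h + h ^+ 2 * 'X^3)
  - 'X * (2%:R * b0 * r + r ^+ 2 * 'X^3).
have -> : ('X + 2%:R) * (X - 2%:R * 'X * X^`()) ^+ 2
    - 'X * (X ^+ 2 + 2%:R * 'X)
      = ((E * 'X + (62%:R)%:P) * 'X + (12%:R)%:P) * 'X^3.
  by rewrite dX /X Xr !polyC_natr /E /h /a0 /b0; ring.
rewrite mulf_eq0 expf_eq0 polyX_eq0 andbF orbF -size_poly_eq0 size_MXaddC.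
case: ifP => // /andP[]; rewrite -size_poly_eq0 size_MXaddC.
case: ifP => // /andP[_ /eqP c1] _ /eqP c0 _; case/negP: two_neq0; apply/eqP.
(* 62 - 5 * 12 = 2 *)
by rewrite -[RHS](subr0 0) -{1}c1 -(mulr0 5%:R) -c0; ring.
Qed.

Lemma quad_orbitS_sqrB (R : comNzRingType) (a : R) m :
  quad_orbit a m.+1 - a ^+ 2 - a = quad_orbit a m ^+ 2 - a ^+ 2.
Proof. by rewrite quad_orbitS; ring. Qed.

(** * Heights of polynomials, and divisibility by squares *)

Section Height.
Variable k : fieldType.
Implicit Types f g : {poly k}.

Lemma height_le f n : (height f <= n)%N = (size f <= n.+1)%N.
Proof. by rewrite /height; case: (size f). Qed.

Lemma height0 : height (0 : {poly k}) = 0%N.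
Proof. by rewrite /height size_poly0. Qed.

Lemma heightM f g : f != 0 -> g != 0 -> height (f * g) = (height f + height g)%N.
Proof.
move=> f0 g0; rewrite /height size_mul //.
move: f0 g0; rewrite -!size_poly_gt0.
by case: (size f) (size g) => [|a] [|b] // _ _; rewrite addnS.
Qed.

Lemma heightX f n : height (f ^+ n) = (height f * n)%N.
Proof. exact: size_exp. Qed.

Lemma heightM_le f g : (height (f * g) <= height f + height g)%N.
Proof.
have [->|f0] := eqVneq f 0; first by rewrite mul0r height0.
have [->|g0] := eqVneq g 0; first by rewrite mulr0 height0.
by rewrite heightM.
Qed.

Lemma heightD_le f g h :
  (height f <= h -> height g <= h -> height (f + g) <= h)%N.
Proof.
rewrite !height_le => fh gh.
by rewrite (leq_trans (size_polyD f g)) // geq_max fh gh.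
Qed.

Lemma heightDl f g : (height g < height f)%N -> height (f + g) = height f.
Proof.
move=> gf; rewrite /height size_polyDl // ltnNge.
by apply: contraL gf => szf; rewrite -leqNgt /height -!subn1 leq_sub2r.
Qed.

Lemma heightN f : height (- f) = height f.
Proof. by rewrite /height size_polyN. Qed.

Lemma height_natrM n f : (height (n%:R * f) <= height f)%N.
Proof.
rewrite -polyC_natr (leq_trans (heightM_le _ _)) // /height size_polyC.
by case: (_ != 0).
Qed.

Lemma height_deriv f : (height f^`() <= (height f).-1)%N.
Proof.
have [->|f0] := eqVneq f 0; first by rewrite deriv0 height0.
move: (lt_size_deriv f0); rewrite height_le /height.
by case: (size f) => [|[|n]] //; rewrite ltnS => /leq_trans->.
Qed.

Lemma heightM_deriv f g : (height (f * g^`()) <= height f + (height g).-1)%N.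
Proof. by rewrite (leq_trans (heightM_le _ _)) // leq_add2l height_deriv. Qed.

Lemma height_quad_orbit_le f m : (height (quad_orbit f m.+1) <= 2 ^ m * height f)%N.
Proof.
elim: m => [|m IHm]; first by rewrite /quad_orbit /= expr0n add0r mul1n.
rewrite quad_orbitS heightD_le // ?heightX.
  by rewrite expnS mulnC -mulnA leq_mul2l.
by rewrite leq_pmull // expn_gt0.
Qed.

Lemma height_quad_orbit f m :
  (0 < height f)%N -> height (quad_orbit f m.+1) = (2 ^ m * height f)%N.
Proof.
move=> f_gt0; rewrite {1}/height size_quad_orbit //.
by move: f_gt0; rewrite /height; case: (size f) => [|[]].
Qed.

Lemma height_quad_orbit_sqrD f m (X := quad_orbit f m.+1) :
  (0 < height f)%N -> height (X ^+ 2 + 2%:R * f) = (2 * height X)%N.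
Proof.
move=> f_gt0; have hX := height_quad_orbit m f_gt0.
rewrite heightDl heightX 1?mulnC // (leq_ltn_trans (height_natrM _ _)) //.
by rewrite /X hX mulnA -expnS ltn_Pmull // -{1}(expn0 2) ltn_exp2l.
Qed.

(** After division by g = gcd(u, z) the cofactors are coprime, so (u/g)^2 divides [f];
    squarefreeness makes u/g a unit. *)
Lemma squarefree_dvd f u z :
  squarefree f -> u != 0 -> u ^+ 2 %| f * z ^+ 2 -> u %| z.
Proof.
move=> f_sqf u0 u2_dvd; pose g := gcdp u z.
have g0 : g != 0 by rewrite gcdp_eq0 negb_and u0.
have Du : u = u %/ g * g by rewrite divpK ?dvdp_gcdl.
have Dz : z = z %/ g * g by rewrite divpK ?dvdp_gcdr.
have co_uz : coprimep (u %/ g) (z %/ g) by rewrite coprimep_div_gcd ?u0.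
move: u2_dvd; rewrite Du Dz !exprMn [f * _]mulrA dvdp_mul2r ?expf_neq0 //.
rewrite Gauss_dvdpl ?coprimep_expl ?coprimep_expr // => u1_dvd.
have : size (u %/ g) == 1%N by apply: contraTT u1_dvd => /f_sqf.
by rewrite size_poly_eq1 => u1; rewrite dvdp_mul2r // (eqp_dvdl _ u1) dvd1p.
Qed.

End Height.

(** * The height bound for a parameter with nonzero derivative *)

Lemma height_quad_orbit_sqfree (k : fieldType) (sg d w : {poly k}) m :
  2%:R != 0 :> k -> sg^`() != 0 ->
  d * w ^+ 2 = quad_orbit sg m.+3 ^+ 2 + 2%:R * sg ->
  (height (quad_orbit sg m.+2) <= height d + 4 * height sg)%N.
Proof.
move=> two_neq0 dsg0; set Y := quad_orbit sg m.+2.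
set X := quad_orbit sg m.+3; set G := X ^+ 2 + 2%:R * sg => dwG.
have two0 : 2%:R != 0 :> {poly k} by rewrite -polyC_natr polyC_eq0.
have XY : X = Y ^+ 2 + sg by [].
have sg0 : sg != 0 by apply: contraNneq dsg0 => ->; rewrite deriv0.
have hsg : (0 < height sg)%N.
  rewrite lt0n; apply: contraNneq dsg0 => hsg.
  by rewrite [sg]size1_polyC ?derivC // -subn_eq0 subn1; apply/eqP.
have hX : height X = (2 ^ m.+2 * height sg)%N by rewrite height_quad_orbit.
have hsgX : (height sg < height X)%N.
  by rewrite hX ltn_Pmull // -{1}(expn0 2) ltn_exp2l.
have X0 : X != 0 by apply: contraTneq hsgX => ->; rewrite height0.
have hG : height G = (2 * height X)%N by exact: height_quad_orbit_sqrD.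
have G0 : G != 0.
  by apply: contraTneq hsgX => G0; move: hG; rewrite G0 height0; lia.
have d0 : d != 0 by apply: contraNneq G0 => d0; rewrite -dwG d0 mul0r.
have w0 : w != 0 by apply: contraNneq G0 => w0; rewrite -dwG w0 expr0n mulr0.
have hdw : (height d + 2 * height w = 2 * height X)%N.
  by rewrite -hG -dwG heightM ?expf_neq0 // heightX [(_ * 2)%N]mulnC.
pose W := X * sg^`() - 2%:R * sg * X^`().
(* Since 2 W = X G' - 2 X' G, and [w] divides both G = d w^2 and its derivative, [w] divides [W];
   [q] is the explicit cofactor. *)
pose q := (2%:R^-1)%:P * (X * (d^`() * w + 2%:R * d * w^`()) - 2%:R * d * w * X^`()).
have two_inv : 2%:R * (2%:R^-1)%:P = 1 :> {poly k}.
  by rewrite -polyC_natr -polyCM divff.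
have qW : w * q = W.
  apply: (mulfI two0); rewrite /q.
  have dG : d^`() * w ^+ 2 + d * (2%:R * w * w^`()) = 2%:R * (X * X^`() + sg^`()).
    transitivity (d * w ^+ 2)^`(); first by rewrite !derivE /=; ring.
    by rewrite dwG /G -polyC_natr !derivE /= polyC_natr -mulr_natl; ring.
  transitivity (2%:R * (2%:R^-1)%:P *
    (X * (d^`() * w ^+ 2 + d * (2%:R * w * w^`())) - 2%:R * (d * w ^+ 2) * X^`())).
    by ring.
  by rewrite two_inv dG dwG /G /W; ring.
(* For nonzero [q], twice h(w) + h(q) = h(W) <= h(X) + h(sg) - 1 is compared with h(d) + 2 h(w) = 2
   h(X). For q = 0 the bound follows from h(sg) > 0. *)
have hq : (2 * height q + 2 <= height d + 2 * height sg)%N.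
  have hW : (height W <= height X + (height sg).-1)%N.
    apply: heightD_le; first exact: heightM_deriv.
    rewrite heightN -mulrA (leq_trans (height_natrM _ _)) //.
    rewrite (leq_trans (heightM_deriv _ _)) //; lia.
  have [->|q0] := eqVneq q 0; first by rewrite height0; lia.
  by move: hW; rewrite -qW heightM //; lia.
have dW : d * W ^+ 2 = q ^+ 2 * G by rewrite -qW -dwG; ring.
rewrite leqNgt; apply/negP => hY.
(* Modulo [Y], [X] is [sg] and X' is sg', so [W] is - sg sg' and [G] is sg^2 + 2 sg. Thus [T] is the
   residue of d W^2 - q^2 G, which is 0. *)
pose T := d * sg ^+ 2 * sg^`() ^+ 2 - q ^+ 2 * (sg ^+ 2 + 2%:R * sg).
have dX : X^`() = 2%:R * Y * Y^`() + sg^`() by rewrite XY !derivE /=; ring.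
have Y_dvd : Y %| T.
  (* Chosen so that W = - sg sg' + Y u exactly. *)
  pose u := Y * sg^`() - 4%:R * sg * Y^`().
  have -> : T = (d * (2%:R * sg * sg^`() * u - Y * u ^+ 2)
                 + q ^+ 2 * (Y ^+ 3 + 2%:R * sg * Y)) * Y.
    transitivity (T - d * W ^+ 2 + q ^+ 2 * G); first by rewrite dW; ring.
    by rewrite /T /W /G dX XY /u; ring.
  exact: dvdp_mulIr.
have hT : (height T <= height d + 4 * height sg)%N.
  apply: heightD_le.
    rewrite (leq_trans (heightM_le _ _)) // heightX.
    have := heightM_le d (sg ^+ 2); rewrite heightX => hdsg.
    rewrite (leq_trans (leq_add hdsg (leq_mul (height_deriv sg) (leqnn 2)))) //.
    by lia.
  rewrite heightN (leq_trans (heightM_le _ _)) // heightX.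
  have : (height (sg ^+ 2 + 2%:R * sg)%R <= 2 * height sg)%N.
    apply: heightD_le; first by rewrite heightX mulnC.
    by rewrite (leq_trans (height_natrM _ _)) //; lia.
  by lia.
have T0 : T = 0.
  apply/eqP; apply: contraLR (leq_ltn_trans hT hY) => T0.
  by rewrite -leqNgt /height -!subn1 leq_sub2r // dvdp_leq.
have dq : d * sg * sg^`() ^+ 2 = q ^+ 2 * (sg + 2%:R).
  by apply: (mulfI sg0); apply/eqP; rewrite -subr_eq0 -T0 /T; apply/eqP; ring.
have q0 : q != 0.
  apply: contraNneq d0 => q0; move/eqP: dq.
  by rewrite q0 expr0n mul0r 2!mulf_eq0 expf_eq0 (negPf sg0) (negPf dsg0) !orbF.
have compE (U V : {poly k}) :
    (('X + 2%:R) * U ^+ 2 - 'X * (V ^+ 2 + 2%:R * 'X)) \Po sg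
      = (sg + 2%:R) * (U \Po sg) ^+ 2 - sg * ((V \Po sg) ^+ 2 + 2%:R * sg).
  rewrite -polyC_natr !expr2 comp_polyB !(comp_polyM, comp_polyD).
  by rewrite !comp_polyX !comp_polyC.
pose P : {poly k} := quad_orbit 'X m.+3.
have XP : X = P \Po sg by rewrite /P (rmorph_quad_orbit (comp_poly sg)) /= comp_polyX.
have WP : W = sg^`() * ((P - 2%:R * 'X * P^`()) \Po sg).
  rewrite /W XP deriv_comp rmorphB !rmorphM /= rmorph_nat /= comp_polyX; ring.
(* After multiplication by q^2, [dq] and [dW] eliminate [d] and [q] together. *)
have main : (sg + 2%:R) * W ^+ 2 = sg * sg^`() ^+ 2 * G.
  apply: (mulfI (expf_neq0 2 q0)).
  rewrite mulrA -dq; transitivity (sg * sg^`() ^+ 2 * (d * W ^+ 2)); first by ring.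
  by rewrite dW; ring.
apply: (@quad_orbit_no_identity k m two_neq0); apply/eqP; rewrite -/P -subr_eq0.
(* Composition with the non-constant [sg] is injective, so the relation descends to the excluded
   identity in x. *)
have sg_gt1 : (1 < size sg)%N by move: hsg; rewrite /height; case: (size sg) => [|[]].
rewrite -(comp_poly_eq0 _ sg_gt1); apply/eqP; apply: (mulfI (expf_neq0 2 dsg0)).
rewrite mulr0 compE -XP mulrBr.
apply/eqP; rewrite subr_eq0; apply/eqP.
transitivity ((sg + 2%:R) * W ^+ 2); first by rewrite WP; ring.
by rewrite main /G; ring.
Qed.

(** * Extraction of p-power roots in characteristic p *)

(** Only exponents divisible by [p] survive, so [f] is a polynomial in x^p; its coefficients have
    p-th roots in the algebraically closed [k], and Frobenius is additive. *)
Lemma deriv_eq0_expp (p : nat) (k : closedFieldType) (f : {poly k}) :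
  p \in [pchar k] -> f^`() = 0 -> exists g : {poly k}, f = g ^+ p.
Proof.
move=> pchar_k f'0; have p_gt0 := prime_gt0 (pcharf_prime pchar_k).
have [h ->] : exists h : {poly k}, f = h \Po 'X^p.
  exists (\poly_(i < size f) f`_(i * p)); apply/polyP=> i.
  rewrite coef_comp_poly_Xn //; case: ifP => [/dvdnP[j ->]|p_ndvd].
    rewrite mulnK // coef_poly; case: ltnP => // size_le.
    by rewrite nth_default // (leq_trans size_le) // leq_pmulr.
  have iN0 : i%:R != 0 :> k by rewrite -(dvdn_pcharf pchar_k) p_ndvd.
  apply: (mulfI iN0); rewrite mulr0 mulr_natl.
  by case: i {p_ndvd iN0} => // i; rewrite -coef_deriv f'0 coef0.
elim/poly_ind: h => [|h c [g hg]].
  by exists 0; rewrite comp_poly0 expr0n gtn_eqF.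
have /closed_rootP[b] : size ('X^p - c%:P) != 1%N.
  by rewrite size_XnsubC // eqSS -lt0n.
rewrite rootE !hornerE subr_eq0 => /eqP <-.
have pchar_poly_k : [pchar {poly k}].-nat p.
  by rewrite (eq_pnat _ (@pchar_poly k)) pnatE ?(pcharf_prime pchar_k).
exists (g * 'X + b%:P); rewrite exprDn_pchar // exprMn -polyC_exp -hg.
by rewrite comp_polyD comp_polyM comp_polyX comp_polyC.
Qed.

(** Each p-th root divides the positive height by [p], so root extraction stops, and it can stop
    only at a nonzero derivative. *)
Lemma separable_root_pchar (p : nat) (k : closedFieldType) (f : {poly k}) :
  p \in [pchar k] -> (0 < height f)%N ->
  exists i (g : {poly k}), f = g ^+ (p ^ i) /\ g^`() != 0.
Proof.
move=> pchar_k; have p_gt1 := prime_gt1 (pcharf_prime pchar_k).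
have [n] := ubnP (height f); elim: n f => // n IHn f f_lt f_gt0.
have [/(deriv_eq0_expp pchar_k)[g Df]|f'0] := eqVneq f^`() 0; last first.
  by exists 0, f; rewrite expn0 expr1.
have hf : height f = (height g * p)%N by rewrite Df heightX.
have [| |i [h [Dg h'0]]] := IHn g; [nia | nia |].
by exists i.+1, h; rewrite Df Dg expnSr exprM.
Qed.

(** * The post-critical orbit and the final bound *)

Lemma phi_polyE (k : fieldType) (c1 s x : {poly k}) (eta : k) :
  (phi_poly c1 s eta).[x] = (x + (c1 + eta *: s)) ^+ 2 - c1.
Proof. by rewrite /phi_poly !hornerE. Qed.

(* The translation by c1 + eta sqrt(c1) conjugates phi to y^2 + eta sqrt(c1)
   and moves the critical point to 0. *)
Lemma post_critE (k : fieldType) (s : {poly k}) (eta : k) n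
    (sg := eta *: s) : eta ^+ 2 = 1 ->
  post_crit (s ^+ 2) s eta n.+2 = quad_orbit sg n.+1 ^+ 2 - sg ^+ 2.
Proof.
move=> eta2; have sg2 : s ^+ 2 = sg ^+ 2 by rewrite exprZn eta2 scale1r.
(* In the form Y_n - sg^2 - sg the claim is a plain induction from index 0, where Y_0 = 0 gives the
   critical point. *)
rewrite -quad_orbitS_sqrB /post_crit /crit_pt sg2 -/sg.
have -> : (n.+2 == 1)%N = false by [].
elim: n.+2 => [|m IHm]; first by rewrite /quad_orbit /=; ring.
by rewrite iterS IHm phi_polyE -/sg quad_orbitS; ring.
Qed.

Theorem theorem2p8
  (p : nat) (p_prime : prime p) (p_odd : odd p)
  (k : closedFieldType) (iota : {rmorphism 'F_p -> k})
  (k_closure : alg_closure_Fp iota)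
  (c1 s : {poly k}) (s_sqrt : c1 = s ^+ 2)
  (eta : k) (eta_sign : eta = 1 \/ eta = -1)
  (phi_non_isotrivial : ~ isotrivial (phi_poly c1 s eta))
  (e : nat) (e_insep : dyn_insep_degree p c1 e)
  (d : nat -> {poly k})
  (d_sqfree : forall n : nat, (1 <= n)%N ->
     squarefree_part (post_crit c1 s eta n) (d n))
  (d1' : {poly k}) (d1'_sqfree : squarefree_part s d1')
  (rad_c1 : {poly k}) (rad_c1P : is_rad c1 rad_c1)
  (rad_s2 : {poly k}) (rad_s2P : is_rad (s + 2%:R) rad_s2) :
  let A := (8 * p ^ e)%N in
  let B := (8 * p ^ e *
              (height d1' + 4 + 4 * height rad_c1 + 4 * height rad_s2)
            + 10 * height c1)%N in
  forall n : nat, (4 <= n)%N ->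
    (height (post_crit c1 s eta (n - 2)) <= A * height (d n) + B)%N.
Proof.
move=> A B [|[|[|[|n]]]] // _; rewrite s_sqrt in e_insep d_sqfree B *.
have eta2 : eta ^+ 2 = 1 by case: eta_sign => ->; rewrite ?sqrrN expr1n.
have eta0 : eta != 0 by case: eta_sign => ->; rewrite ?oppr_eq0 oner_eq0.
rewrite subSS subSS subn0 post_critE //.
set sg := eta *: s.
have hsg : height sg = height s by rewrite /height size_scale.
(* The smallest index bounds c_2 = sg^2 - sg^2 = 0. *)
case: n => [|m].
  by rewrite /quad_orbit /= expr0n add0r subrr height0.
(* If [s] is constant, so is the whole orbit, and the left side is 0. *)
have [hs0|hs] := posnP (height s).
  have := height_quad_orbit_le sg m.+1; rewrite hsg hs0 muln0 leqn0 => /eqP hQ.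
  by rewrite (leq_trans (heightD_le (h := 0) _ _)) ?heightN ?heightX ?hQ ?hsg ?hs0.
have pchar_k : p \in [pchar k].
  exact: (rmorph_pchar iota (pchar_Fp p_prime)).
have two_neq0 : 2%:R != 0 :> k.
  rewrite -(dvdn_pcharf pchar_k); apply: contraL p_odd => /dvdn_leq p_le2.
  by have -> : p = 2%N by have := prime_gt1 p_prime; have := p_le2 isT; lia.
have [i [t [Ds t'0]]] := separable_root_pchar pchar_k hs.
(* c_1 = (t^2)^(p^i), so the maximality of [e] applies. *)
have i_le_e : (i <= e)%N.
  case: e_insep => _; apply; exists (tofrac (t ^+ 2)).
  by rewrite Ds -rmorphXn -!exprM mulnC.
set P := (p ^ i)%N in Ds.
have P_odd : odd P by rewrite oddX p_odd orbT.
have P_gt0 : (0 < P)%N by rewrite expn_gt0 prime_gt0.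
have P_le : (P <= p ^ e)%N by rewrite leq_exp2l ?prime_gt1.
have P_pchar : [pchar {poly k}].-nat P.
  by rewrite (eq_pnat _ (@pchar_poly k)) pnatX pnatE // pchar_k.
have DP : P = (P./2 * 2 + 1)%N by rewrite muln2 addn1 -{1}(odd_double_half P) P_odd.
pose tau := eta *: t.
(* [P] is odd and eta^2 = 1, so eta^P = eta. *)
have Dsg : sg = tau ^+ P.
  by rewrite exprZn /sg Ds [eta ^+ P](_ : _ = eta) // DP exprD mulnC exprM eta2 expr1n mul1r.
have tau'0 : tau^`() != 0 by rewrite derivZ scaler_eq0 negb_or eta0.
have htau : height s = (height tau * P)%N by rewrite -hsg Dsg heightX.
have htau0 : (0 < height tau)%N by move: hs; rewrite htau muln_gt0 => /andP[].
pose Y := quad_orbit tau m.+2; pose X := quad_orbit tau m.+3.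
pose G := X ^+ 2 + 2%:R * tau.
have [d_sqf [z Dz]] := d_sqfree m.+4.+1 isT.
have Dc : post_crit (s ^+ 2) s eta m.+4.+1 = (X ^+ 2 * G) ^+ P.
  rewrite post_critE // -/sg Dsg quad_orbit_exp_pchar // -!exprM ![(P * 2)%N]mulnC.
  rewrite !exprM -exprNn_pchar // -exprDn_pchar // quad_orbitS -/X /G; congr (_ ^+ _); ring.
have hX : (0 < height X)%N by rewrite height_quad_orbit // muln_gt0 expn_gt0.
have X0 : X != 0 by apply: contraTneq hX => ->; rewrite height0.
have hG : height G = (2 * height X)%N by exact: height_quad_orbit_sqrD.
have G0 : G != 0 by apply: contraTneq hX => G0; move: hG; rewrite G0 height0; lia.
(* As [P] is odd, (X^2 G)^P is the square of this polynomial times [G]. Squarefreeness of d_n lets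
   the square be cancelled from z^2, which leaves d_n w^2 = G. *)
have u0 : X * (X ^+ 2 * G) ^+ P./2 != 0 by rewrite !(mulf_neq0, expf_neq0).
have Dz' : d m.+4.+1 * z ^+ 2 = (X * (X ^+ 2 * G) ^+ P./2) ^+ 2 * G.
  by rewrite -Dz Dc [in LHS]DP exprD exprM expr1; ring.
have /dvdpP[w Dw] : X * (X ^+ 2 * G) ^+ P./2 %| z.
  by apply: squarefree_dvd d_sqf u0 _; rewrite Dz' dvdp_mulIl.
have dwG : d m.+4.+1 * w ^+ 2 = G.
  by apply: (mulfI (expf_neq0 2 u0)); rewrite -Dz' Dw; ring.
have hY := height_quad_orbit_sqfree two_neq0 tau'0 dwG.
have hc : (height (quad_orbit sg m.+2 ^+ 2 - sg ^+ 2) <= 2 * P * height Y)%N.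
  have htauY : (height tau <= height Y)%N.
    by rewrite height_quad_orbit // leq_pmull // expn_gt0.
  rewrite Dsg quad_orbit_exp_pchar // -/Y.
  apply: heightD_le; rewrite ?heightN !heightX -mulnA [(P * 2)%N]mulnC mulnC //.
  by rewrite leq_mul2l htauY orbT.
(* The bound obtained is 2 P (h(d_n) + 4 h(tau)) = 2 P h(d_n) + 8 h(s), where P <= p^e and 10 h(c_1)
   = 20 h(s). *)
rewrite (leq_trans hc) // /A /B heightX htau.
move: hY P_le; rewrite -/Y; nia.
Qed.
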